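(* Let $w$ be a finite word or a (right-)infinite word over some alphabet. The following are equivalent: (A) $w$ is rich; (B) for every non-palindromic factor $u$ of $w$, letting $p$ denote the longest palindromic prefix of $u$ and $q$ the longest palindromic suffix of $u$, we have $p \neq q$, $p$ is not a factor of $q$, $q$ is not a factor of $p$, and $u$ is the only non-palindromic factor of $w$ whose longest palindromic prefix is $p$ and whose longest palindromic suffix is $q$ (i.e., $u$ is uniquely determined by the pair $(p,q)$).
   Context: For a finite word $w = x_1x_2\cdots x_m$ (letters $x_i$), $|w| = m$ is its length and $\tilde w = x_m\cdots x_2x_1$ its reversal; $w$ is a palindrome if $w = \tilde w$, and the empty word $\varepsilon$ is considered a palindrome. A finite word $z$ is a factor of a finite or infinite word $w$ if $w = uzv$ for some words $u,v$; it is a prefix if $u=\varepsilon$ and a suffix if $v = \varepsilon$. Every finite word has a longest palindromic prefix and a longest palindromic suffix (possibly $\varepsilon$). A finite word $w$ is rich if it has exactly $|w|+1$ distinct palindromic factors (including $\varepsilon$); an infinite word is rich if all of its finite factors are rich. *)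

(* Defs.v *)
From mathcomp Require Import all_boot.

Set Implicit Arguments.
Unset Strict Implicit.
Unset Printing Implicit Defensive.

Variant word (T : Type) := FinWord of seq T | InfWord of (nat -> T).

Section Words.

Variable T : eqType.
Implicit Types (u v z p q : seq T) (w : word T).

Definition palindrome u : bool := u == rev u.

Definition scat (u : seq T) (v : nat -> T) : nat -> T :=
  fun n => if n < size u then nth (v 0) u n else v (n - size u).

Definition factor z w : Prop :=
  match w with
  | FinWord u => infix z u
  | InfWord x => exists (u : seq T) (v : nat -> T), x =1 scat u (scat z v)
  end.

Definition finrich u : Prop :=
  exists s : seq (seq T),
    [/\ uniq s,
        forall z, (z \in s) = palindrome z && infix z u
      & size s = (size u).+1].

Definition rich w : Prop :=
  match w with
  | FinWord u => finrich u
  | InfWord _ => forall z, factor z w -> finrich z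
  end.

Definition longest_pal_prefix p u : Prop :=
  [/\ palindrome p, prefix p u
    & forall p', palindrome p' -> prefix p' u -> size p' <= size p].

Definition longest_pal_suffix q u : Prop :=
  [/\ palindrome q, suffix q u
    & forall q', palindrome q' -> suffix q' u -> size q' <= size q].

Lemma longest_pal_prefix_exists u : exists p, longest_pal_prefix p u.
Proof.
pose P n := palindrome (take n u) && (n <= size u).
have P0 : exists n, P n by exists 0; rewrite /P take0.
have Pb n : P n -> n <= size u by case/andP.
case: (ex_maxnP P0 Pb) => m /andP[pm lem] maxm.
exists (take m u); split=> //; first exact: prefix_take.
move=> p' pp' /prefixP[s us]; rewrite size_takel //; apply: maxm.
by rewrite /P us take_size_cat // pp' size_cat leq_addr.
Qed.

Lemma longest_pal_suffix_exists u : exists q, longest_pal_suffix q u.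
Proof.
have palr z : palindrome (rev z) = palindrome z.
  by rewrite /palindrome revK eq_sym.
have [p [pp pre maxp]] := longest_pal_prefix_exists (rev u).
exists (rev p); split; first by rewrite palr.
  by rewrite -prefix_rev revK.
move=> q' pq' suf; rewrite size_rev -(size_rev q'); apply: maxp.
  by rewrite palr.
by rewrite prefix_rev.
Qed.

Lemma longest_pal_prefix_uniq u p p' :
  longest_pal_prefix p u -> longest_pal_prefix p' u -> p = p'.
Proof.
move=> [pp pre maxp] [pp' pre' maxp'].
have sz : size p = size p' by apply/eqP; rewrite eqn_leq maxp ?maxp'.
by move: pre pre'; rewrite !prefixE sz => /eqP e /eqP; apply: etrans (esym e).
Qed.

Lemma longest_pal_suffix_uniq u q q' :
  longest_pal_suffix q u -> longest_pal_suffix q' u -> q = q'.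
Proof.
move=> [pq suf maxq] [pq' suf' maxq'].
have sz : size q = size q' by apply/eqP; rewrite eqn_leq maxq ?maxq'.
by move: suf suf'; rewrite !suffixE sz => /eqP e /eqP; apply: etrans (esym e).
Qed.

End Words.

(* Main.v *)
Require Import Defs.
From Corelib Require Import Setoid.
From mathcomp Require Import all_boot.

Set Implicit Arguments.
Unset Strict Implicit.
Unset Printing Implicit Defensive.

(** Appending a letter to a word creates at most one new palindromic factor,
    namely its longest palindromic suffix, so a word is rich iff the longest
    palindromic suffix of each of its prefixes occurs there only once.

    If some prefix has a longest palindromic suffix [q] with an earlier
    occurrence, the factor running from that occurrence to the end of the
    prefix is not a palindrome, has longest palindromic suffix [q], and [q] is
    a prefix of its longest palindromic prefix; this contradicts (B).

    Conversely, unioccurrence in a rich word yields the first three clauses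
    of (B).  For uniqueness, let a rich word [z] start with [u] and end with
    [v], both of type [(p, q)].  Since [p] occurs twice in [z], the longest
    palindromic prefix of [z] is longer than [u] and ends with [rev u], which
    has type [(q, p)].  So a proper suffix of [z] starts with [rev u] and
    ends with [v], and one descends on the length of [z], alternating between
    the types [(p, q)] and [(q, p)]. *)

Section Lists.

Variable T : Type.
Implicit Types a b c d : seq T.

(** Levi's lemma, oriented by length. *)
Lemma cat_eq_cat_le a b c d : a ++ b = c ++ d -> size a <= size c ->
  exists2 r, c = a ++ r & b = r ++ d.
Proof.
elim: a c => [|x a IHa] [|y c] //=; first by exists [::].
- by move->; exists (y :: c).
- by case=> -> /IHa h /h[r -> ->]; exists r.
Qed.

End Lists.

Section RichWords.

Variable T : eqType.
Implicit Types (u v z p q : seq T) (w : word T).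

(** * Palindromes and reversal *)

Lemma palindromeP u : reflect (rev u = u) (palindrome u).
Proof. by apply: (iffP eqP) => /esym. Qed.

Lemma palindrome_rev u : palindrome (rev u) = palindrome u.
Proof. by rewrite /palindrome revK eq_sym. Qed.

Lemma longest_pal_prefix_rev p u :
  longest_pal_suffix p u -> longest_pal_prefix p (rev u).
Proof.
move=> [/[dup] pp /palindromeP rp sp mp]; split=> //.
  by rewrite -rp prefix_rev.
move=> p' pp' pre; apply: mp => //.
by rewrite -prefix_rev (palindromeP _ pp').
Qed.

Lemma longest_pal_suffix_rev p u :
  longest_pal_prefix p u -> longest_pal_suffix p (rev u).
Proof.
move=> [/[dup] pp /palindromeP rp sp mp]; split=> //.
  by rewrite -rp suffix_rev.
move=> p' pp' pre; apply: mp => //.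
by rewrite -suffix_rev (palindromeP _ pp').
Qed.

(** * Counting palindromic factors *)

Definition pal_factors u : seq (seq T) :=
  undup [seq z <- [seq take j (drop i u) | i <- iota 0 (size u).+1,
                                           j <- iota 0 (size u).+1]
        | palindrome z].

Lemma mem_pal_factors z u : (z \in pal_factors u) = palindrome z && infix z u.
Proof.
rewrite mem_undup mem_filter; congr (_ && _).
apply/allpairsP/idP => [[[i j] /= [_ _ ->]]|/infixP[a [b ->]]].
  by apply: infix_trans (infix_take _ _) (infix_drop _ _).
exists (size a, size z); rewrite !mem_iota !size_cat /= !add0n !ltnS.
by rewrite leq_addr addnCA leq_addr drop_size_cat // take_size_cat.
Qed.

Lemma finrichE u : finrich u <-> size (pal_factors u) = (size u).+1.
Proof.
split=> [[s [us ms <-]]|szu].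
  apply/eqP; rewrite -uniq_size_uniq ?undup_uniq // => z.
  by rewrite ms mem_pal_factors.
by exists (pal_factors u); split; rewrite ?undup_uniq // => z; rewrite mem_pal_factors.
Qed.

Lemma finrich_rev u : finrich u -> finrich (rev u).
Proof.
case=> s [us ms ss]; exists s; split=> //; last by rewrite size_rev.
move=> z; rewrite ms; case: (palindromeP z) => //= rz.
by rewrite -{2}rz infix_rev.
Qed.

(* A shorter palindromic suffix is a suffix, hence a prefix, of the longest
   one, so it already occurs in [u]. *)
Lemma pal_suffix_rcons z u a q : longest_pal_suffix q (rcons u a) ->
  palindrome z -> suffix z (rcons u a) -> z = q \/ infix z u.
Proof.
move=> [pq /suffixP[s es] mq] pz sz.
have leq := mq _ pz sz; have [s' es'] := suffixP sz.
have lt_s : size s <= size s'.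
  have /(congr1 size) : s ++ q = s' ++ z by rewrite -es -es'.
  rewrite !size_cat => e; rewrite -(leq_add2r (size z)) -e.
  by rewrite leq_add2l.
have [r _ eq] := cat_eq_cat_le (etrans (esym es) es') lt_s.
case: (lastP r) eq => [|r' b] eq; first by left.
right; have eq2 : q = z ++ rev (rcons r' b).
  by rewrite -(palindromeP _ pq) eq rev_cat (palindromeP _ pz).
move: es; rewrite eq2 rev_rcons; case/lastP: (rev r') => [|t c].
  by rewrite cats1 -rcons_cat => /rcons_inj[-> _]; apply: suffixW (suffix_suffix _ _).
rewrite -rcons_cons -!rcons_cat => /rcons_inj[-> _].
exact: infix_infix.
Qed.

Lemma size_pal_factors_rcons u a q : longest_pal_suffix q (rcons u a) ->
  size (pal_factors (rcons u a)) = size (pal_factors u) + ~~ infix q u.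
Proof.
move=> lq; have [pq sq _] := lq.
(* Once the count is the size of a duplicate-free list, equality of sizes reduces to equality of
   members. *)
have -> : size (pal_factors u) + ~~ infix q u =
          size (if infix q u then pal_factors u else q :: pal_factors u).
  by case: ifP; rewrite ?addn0 ?addn1.
apply/eqP; rewrite -uniq_size_uniq ?undup_uniq //.
  by case: ifP => iq; rewrite /= ?undup_uniq ?mem_pal_factors ?iq ?andbF.
move=> z; have -> : (z \in (if infix q u then pal_factors u else q :: pal_factors u))
    = (z == q) || (z \in pal_factors u).
  case: ifP => iq; rewrite ?inE //.
  by case: eqP => // ->; rewrite mem_pal_factors pq iq.
rewrite !mem_pal_factors infix_rconsl.
have [->|/eqP nzq] := eqVneq z q; first by rewrite pq sq.
case: (boolP (palindrome z)) => //= pz.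
have [_|/negP iz] := boolP (infix z u); first by rewrite orbT.
by rewrite orbF; apply/esym/negbTE/negP => /(pal_suffix_rcons lq pz)[].
Qed.

Lemma size_pal_factors_leq u : size (pal_factors u) <= (size u).+1.
Proof.
elim/last_ind: u => [//|u a IHu].
have [q lq] := longest_pal_suffix_exists (rcons u a).
rewrite (size_pal_factors_rcons lq) size_rcons.
by rewrite -[(size u).+2]addn1 leq_add // leq_b1.
Qed.

Lemma finrich_nil : finrich (@nil T).
Proof. exact/finrichE. Qed.

(** A letter adds at most one palindrome and [size_pal_factors_leq] bounds the count for [u], so a
    maximal count for [rcons u a] forces both a maximal count for [u] and a new palindrome. *)
Lemma finrich_rcons u a q : longest_pal_suffix q (rcons u a) ->
  finrich (rcons u a) <-> finrich u /\ ~~ infix q u.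
Proof.
move=> lq; rewrite !finrichE (size_pal_factors_rcons lq) size_rcons.
have := size_pal_factors_leq u.
case: (infix q u) => /=; rewrite ?addn0 ?addn1.
  by move=> le; split=> [e|[]//]; rewrite e ltnn in le.
by move=> _; split=> [[]|[-> _]].
Qed.

(** * Factors of rich words and unioccurrence *)

Lemma finrich_catl u v : finrich (u ++ v) -> finrich u.
Proof.
elim/last_ind: v => [|v a IHv]; first by rewrite cats0.
have [q lq] := longest_pal_suffix_exists (rcons (u ++ v) a).
by rewrite -rcons_cat => /(finrich_rcons lq)[/IHv].
Qed.

Lemma finrich_catr u v : finrich (u ++ v) -> finrich v.
Proof.
by move/finrich_rev; rewrite rev_cat => /finrich_catl/finrich_rev; rewrite revK.
Qed.

Lemma finrich_infix u v : infix u v -> finrich v -> finrich u.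
Proof. by case/infixP=> a [b ->] /finrich_catr/finrich_catl. Qed.

(** Were [b] nonempty, [q] would already occur before the last letter is appended, against
    [finrich_rcons]. *)
Lemma longest_pal_suffix_last u q a b : finrich u -> longest_pal_suffix q u ->
  u = a ++ q ++ b -> b = [::].
Proof.
move=> ru lq eu; case/lastP: b eu => // b c.
rewrite -!rcons_cat => eu; rewrite eu in ru lq.
by case/(finrich_rcons lq): ru => _; rewrite infix_infix.
Qed.

Lemma longest_pal_prefix_first u p a b : finrich u -> longest_pal_prefix p u ->
  u = a ++ p ++ b -> a = [::].
Proof.
move=> /finrich_rev ru lp eu; have [pp _ _] := lp.
move/longest_pal_suffix_rev: lp => lp.
have/(longest_pal_suffix_last ru lp) : rev u = rev b ++ p ++ rev a.
  by rewrite eu !rev_cat (palindromeP _ pp) catA.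
by move/(congr1 rev); rewrite revK.
Qed.

(** * From (B) to richness *)

Lemma finrich_of_not_infix z :
  (forall u, infix u z -> ~~ palindrome u ->
   forall p q, longest_pal_prefix p u -> longest_pal_suffix q u -> ~~ infix q p) ->
  finrich z.
Proof.
elim/last_ind: z => [|z a IHz] B; first exact: finrich_nil.
have [q lq] := longest_pal_suffix_exists (rcons z a).
apply/(finrich_rcons lq); split.
  by apply: IHz => u iu; apply: B; rewrite infix_rconsl iu orbT.
apply/negP => /infixP[x [y ez]]; have [pq /suffixP[t et] mq] := lq.
pose u := q ++ rcons y a.
have eza : rcons z a = x ++ u by rewrite ez /u -!rcons_cat.
have su : suffix u (rcons z a) by rewrite eza suffix_suffix.
(* A palindromic [u] would be a palindromic suffix of [rcons z a] longer than [q]. *)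
have npu : ~~ palindrome u.
  apply/negP => pu; have := mq _ pu su.
  by rewrite /u size_cat size_rcons addnS ltnNge leq_addr.
have [p lp] := longest_pal_prefix_exists u.
have lqu : longest_pal_suffix q u.
  split=> // [|q' pq' sq']; last exact: mq pq' (suffix_trans sq' su).
  have : size x <= size t.
    move: et; rewrite eza => /(congr1 size); rewrite /u !size_cat addnCA addnC => /addIn <-.
    exact: leq_addr.
  by case/(cat_eq_cat_le (etrans (esym eza) et)) => r _ ->; apply: suffix_suffix.
have /negP[] := B u (suffixW su) npu p q lp lqu.
have [_ /prefixP[s es] mp] := lp.
have := mp _ pq (prefix_prefix _ _).
by case/(cat_eq_cat_le es) => r -> _; apply/prefixW/prefix_prefix.
Qed.

(** * Uniqueness of the factor with a given pair *)

Definition pal_type p q u :=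
  [/\ ~~ palindrome u, longest_pal_prefix p u & longest_pal_suffix q u].

Lemma pal_type_rev p q u : pal_type p q u -> pal_type q p (rev u).
Proof.
case=> npu lp lq; split; first by rewrite palindrome_rev.
- exact: longest_pal_prefix_rev.
- exact: longest_pal_suffix_rev.
Qed.

(** If the longest palindromic prefix [P] of [z] were no longer than [u], it would be a prefix of
    [p] and recur with it, against [longest_pal_prefix_first]. So [P] properly extends [u], and its
    reversal, again [P], ends with [rev u] at a nonzero position. *)
Lemma finrich_recurrent_pal_prefix z u y p x t : finrich z -> z = u ++ y ->
  longest_pal_prefix p u -> z = x ++ p ++ t -> x <> [::] ->
  exists y1 y2, z = y1 ++ rev u ++ y2 /\ y1 <> [::].
Proof.
move=> rz ez [pp /prefixP[s es] mp] ez' nx.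
have [P lP] := longest_pal_prefix_exists z; have [pP /prefixP[t' et] mP] := lP.
have [hs|lt_uP] := leqP (size P) (size u); last first.
  have [r eP _] := cat_eq_cat_le (etrans (esym ez) et) (ltnW lt_uP).
  exists (rev r), t'; split.
    by rewrite et -[P](palindromeP _ pP) eP rev_cat catA.
  move/(congr1 size)/eqP; rewrite size_rev size_eq0 => /eqP r0.
  by rewrite eP r0 cats0 ltnn in lt_uP.
have [r eu _] := cat_eq_cat_le (etrans (esym et) ez) hs.
have sPp : size P <= size p by apply: mp; rewrite // eu prefix_prefix.
have [r' ep _] := cat_eq_cat_le (etrans (esym eu) es) sPp.
case: nx; apply: (@longest_pal_prefix_first z P x (r' ++ t) rz lP).
by rewrite [LHS]ez' {1}ep -catA.
Qed.

(** Both claims share one induction on the length of [z], since each claim for [u] is the other one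
    for [rev u]. *)
Lemma finrich_pal_type_eq p q z u v x y : finrich z ->
  z = u ++ y -> z = x ++ v -> pal_type p q u ->
  (pal_type p q v -> v = u) /\ (pal_type q p v -> v = rev u).
Proof.
have [n] := ubnP (size z); elim: n p q z u v x y => // n IHn p q z u v x y.
rewrite ltnS => szn rz ez ez' tu; have [npu lp lq] := tu.
have rv : finrich v by apply: (@finrich_catr x); rewrite -ez'.
(* If this [rev u] starts no later than [v], dropping [y1] gives a shorter word for the induction
   hypothesis; otherwise it lies in [v] at a nonzero position. *)
have step y1 y2 : z = y1 ++ rev u ++ y2 -> y1 <> [::] ->
    ((pal_type q p v -> v = rev u) /\ (pal_type p q v -> v = u))
    \/ (exists2 r, r <> [::] & v = r ++ rev u ++ y2).
  move=> e ny1; have [le|lt_xy] := leqP (size y1) (size x).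
    have [x' _ e'] := cat_eq_cat_le (etrans (esym e) ez') le.
    left; rewrite -{2}[u]revK.
    apply: (IHn q p (rev u ++ y2) (rev u) v x' y2) => //.
    - apply: leq_trans szn; rewrite e [X in _ < X]size_cat.
      by case: y1 ny1 {e le} => //= *; rewrite addSn ltnS leq_addl.
    - by apply: (@finrich_catr y1); rewrite -e.
    - exact: pal_type_rev.
  have [r ey e'] := cat_eq_cat_le (etrans (esym ez') e) (ltnW lt_xy).
  by right; exists r => // r0; rewrite ey r0 cats0 ltnn in lt_xy.
have [nru [pq /prefixP[s es] _] _] := pal_type_rev tu.
split=> tv; have [npv lpv lqv] := tv.
  (* With [x] empty, [u] is a prefix of [v] ending in [q], and [q] occurs in [v] only at its end. *)
  have [x0|nx] := eqVneq x [::].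
    have [_ /suffixP[k ek] _] := lq.
    rewrite x0 /= ez in ez'.
    have y0 : y = [::].
      apply: (longest_pal_suffix_last rv lqv (a := k)).
      by rewrite -ez' ek catA.
    by rewrite -ez' y0 cats0.
  have [_ /prefixP[k ek] _] := lpv.
  have ez2 : z = x ++ p ++ k by rewrite -ek.
  have [y1 [y2 [e ny1]]] := finrich_recurrent_pal_prefix rz ez lp ez2 (elimN eqP nx).
  have [[_]|[r nr ev]] := step _ _ e ny1; first exact.
  (* [rev u] starts with [q], whose only occurrence in [v] is final, so [rev u] would be the
     palindrome [q]. *)
  have /nilP : s ++ y2 = [::].
    by apply: (longest_pal_suffix_last rv lqv (a := r)); rewrite [LHS]ev es -catA.
  rewrite /nilp size_cat addn_eq0 => /andP[/nilP s0 _].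
  by move: nru; rewrite es s0 cats0 pq.
(* For type [(q, p)] the recurrence of [p] is the one ending [v]; it is not initial, as [v] is not a
   palindrome. *)
have [pp /suffixP[k ek] _] := lqv.
have ez2 : z = (x ++ k) ++ p ++ [::] by rewrite cats0 -catA -ek.
have nxk : x ++ k <> [::].
  move/nilP; rewrite /nilp size_cat addn_eq0 => /andP[_ /nilP k0].
  by move: npv; rewrite ek k0 pp.
have [y1 [y2 [e ny1]]] := finrich_recurrent_pal_prefix rz ez lp ez2 nxk.
have [[+ _]|[r nr ev]] := step _ _ e ny1; first exact.
(* Now [q] is the longest palindromic prefix of [v], so the [q] starting [rev u] must be initial in
   [v]. *)
case: nr; apply: (longest_pal_prefix_first rv lpv (b := s ++ y2)).
by rewrite [LHS]ev es -catA.
Qed.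

(** By symmetry [u] starts first. If [v] ends no earlier than [u], the stretch from [u] to [v] fits
    [finrich_pal_type_eq]; otherwise [v] lies inside [u], and unioccurrence of [p] and [q] in [u]
    aligns both ends. *)
Lemma finrich_pal_type_inj p q z u v : finrich z -> infix u z -> infix v z ->
  pal_type p q u -> pal_type p q v -> v = u.
Proof.
move=> rz /infixP[a [b eu]] /infixP[c [d ev]].
wlog le : u v a b c d eu ev / size a <= size c.
  by move=> W tu tv; case: (leqP (size a) (size c)) => [|/ltnW] h;
     [|apply/esym]; apply: W h _ _; eassumption.
move=> tu tv; have [_ lp lq] := tu; have [_ lpv lqv] := tv.
have [c' _ e] := cat_eq_cat_le (etrans (esym eu) ev) le.
have rub : finrich (u ++ b) by apply: (@finrich_catr a); rewrite -eu.
have e' : u ++ b = (c' ++ v) ++ d by rewrite e catA.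
have [hs|/ltnW hs] := leqP (size u) (size (c' ++ v)).
  have [r er _] := cat_eq_cat_le e' hs.
  have rcv : finrich (c' ++ v) by apply: (@finrich_catl _ d); rewrite -e'.
  by case: (finrich_pal_type_eq rcv er erefl tu) => + _; apply.
have ru := finrich_catl rub.
have [d' ed _] := cat_eq_cat_le (esym e') hs.
have [_ /prefixP[k ek] _] := lpv; have [_ /suffixP[l el] _] := lqv.
have c0 : c' = [::].
  apply: (longest_pal_prefix_first ru lp (b := k ++ d')).
  by rewrite {1}ed ek -!catA.
have d0 : d' = [::].
  apply: (longest_pal_suffix_last ru lq (a := c' ++ l)).
  by rewrite {1}ed {1}el -!catA.
by rewrite ed c0 d0 cats0.
Qed.

(** * Factors of finite and infinite words *)

Lemma factor_InfWordE z (x : nat -> T) :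
  factor z (InfWord x) <-> exists n, infix z (mkseq x n).
Proof.
split=> [[u [v ex]]|[n /infixP[a [b e]]]].
  exists (size u + size z); apply/infixP; exists u, [::]; rewrite cats0.
  apply: (@eq_from_nth _ (x 0)) => [|i]; rewrite size_mkseq ?size_cat // => hi.
  rewrite nth_mkseq // ex /scat nth_cat; case: ltnP => hu.
    exact: set_nth_default.
  rewrite ltn_subLR // hi; apply: set_nth_default.
  by rewrite ltn_subLR.
have sn : size a + (size z + size b) = n by rewrite -!size_cat -e size_mkseq.
have nx i : i < n -> x i = nth (x 0) (a ++ z ++ b) i by move=> hi; rewrite -e nth_mkseq.
(* The function is the tail of [x] right after this occurrence of [z]. The defaults of [nth] differ
   below, but every index it reads is in range. *)
exists a, (fun k => x (size a + size z + k)) => i; rewrite /scat.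
case: ltnP => ha.
  rewrite nx; last by rewrite -sn (leq_trans ha) ?leq_addr.
  by rewrite nth_cat ha; apply: set_nth_default.
case: ltnP => hz; last first.
  by rewrite -addnA subnKC // subnKC.
rewrite nx; last by rewrite -sn -ltn_subLR // (leq_trans hz) ?leq_addr.
by rewrite nth_cat ltnNge ha /= nth_cat hz; apply: set_nth_default.
Qed.

Lemma infix_mkseq (x : nat -> T) m n : m <= n -> infix (mkseq x m) (mkseq x n).
Proof.
move=> le; rewrite /mkseq -(subnKC le) iotaD map_cat.
exact/prefixW/prefix_prefix.
Qed.

Lemma factor_infix u z w : infix u z -> factor z w -> factor u w.
Proof.
case: w => [y|x] iu; first exact: infix_trans.
rewrite !factor_InfWordE => -[n iz]; exists n.
exact: infix_trans iz.
Qed.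

(** Lets the uniqueness clause, which compares two factors of [w], be settled inside one finite rich
    word. *)
Lemma factor_common u v w : factor u w -> factor v w ->
  exists z, [/\ factor z w, infix u z & infix v z].
Proof.
case: w => [y|x]; first by exists y; split; rewrite //= infix_refl.
rewrite !factor_InfWordE => -[m iu] [n iv]; exists (mkseq x (maxn m n)); split.
- by apply/factor_InfWordE; exists (maxn m n); apply: infix_refl.
- by apply: infix_trans iu _; apply/infix_mkseq/leq_maxl.
- by apply: infix_trans iv _; apply/infix_mkseq/leq_maxr.
Qed.

Lemma rich_factorP w : rich w <-> (forall z, factor z w -> finrich z).
Proof.
case: w => // y; split=> [ry z iz|]; first exact: finrich_infix iz ry.
by apply; apply: infix_refl.
Qed.

End RichWords.

Theorem theorem1p5 (T : eqType) (w : word T) :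
  rich w <->
  (forall u : seq T, factor u w -> ~~ palindrome u ->
   forall p q : seq T, longest_pal_prefix p u -> longest_pal_suffix q u ->
     [/\ p <> q,
         ~~ infix p q,
         ~~ infix q p
       & forall v : seq T, factor v w -> ~~ palindrome v ->
           longest_pal_prefix p v -> longest_pal_suffix q v -> v = u]).
Proof.
rewrite rich_factorP; split=> [rw u fu npu p q lp lq|B z fz]; last first.
  apply: finrich_of_not_infix => u iu npu p q lp lq.
  by have [] := B u (factor_infix iu fz) npu p q lp lq.
have ru := rw u fu.
have [pp /prefixP[s es] _] := lp; have [pq /suffixP[t et] _] := lq.
(* Inside the suffix [q], the word [p] could only be initial in [u], making [u] equal to the
   palindrome [q]. *)
have npq : ~~ infix p q.
  apply/negP => /infixP[a [b eq]].
  have /nilP : t ++ a = [::].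
    by apply: (longest_pal_prefix_first ru lp (b := b)); rewrite {1}et eq -!catA.
  rewrite /nilp size_cat addn_eq0 => /andP[/nilP t0 _].
  by move: npu; rewrite et t0 pq.
have nqp : ~~ infix q p.
  apply/negP => /infixP[a [b ep]].
  have /nilP : b ++ s = [::].
    by apply: (longest_pal_suffix_last ru lq (a := a)); rewrite {1}es ep -!catA.
  rewrite /nilp size_cat addn_eq0 => /andP[_ /nilP s0].
  by move: npu; rewrite es s0 cats0 pp.
split=> // [epq|v fv npv lpv lqv]; first by rewrite epq infix_refl in npq.
have [z [fz iu iv]] := factor_common fu fv.
by apply: (@finrich_pal_type_inj _ p q z) => //; apply: rw.
Qed.
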